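(* Let $n\ge2$. With respect to the generators $u_l^q$ on the localization $\mathcal{K}$, the virtual Adams operations have the following form for all $k\ge1$, where $d=\gcd(k,n)$ and, when $d\mid l$, $s_1,\dots,s_d\in\{0,\dots,n-1\}$ denote the $d$ solutions $y$ of $ky\equiv l\bmod n$: $$\widetilde\psi^k(u_0^q)=k\,u_0^q\quad(q=0,\dots,n-1),$$ $$\widetilde\psi^k(u_l^q)=\begin{cases}\displaystyle\sum_{i=1}^d u_{s_i}^q & \text{for all } q=0,\dots,n-1,\ \text{if } d\mid l \text{ and } l\ne0,\\[1ex] 0 & \text{if } d\nmid l,\end{cases}$$ $$\widetilde\psi^k(\mathbf{1})=\mathbf{1}.$$
   Context: **K-theory of the inertia of $\mathbb{P}(1,n)$.** Fix $n\ge2$, $\zeta=\exp(2\pi i/n)$, $G=\mathbb{C}^*$. Let $X=\mathbb{C}^2\setminus\{(0,0)\}$ with the action $\lambda\cdot(z_1,z_2)=(\lambda z_1,\lambda^n z_2)$; $\mathbb{P}(1,n)=[X/G]$. The inertia manifold is $I_GX=\coprod_{m\in\mathbb{Z}/n\mathbb{Z}}X^m$, with $X^m$ the fixed locus of $\zeta^m$, and $K(I\mathbb{P}(1,n))_{\mathbb{C}}=K_G(I_GX)\otimes\mathbb{C}$. As a vector space it is $\bigoplus_{m=0}^{n-1}A_m$ with $$A_0=\frac{\mathbb{C}[x_0^{\pm1}]}{\langle (x_0-1)(x_0^n-1)\rangle},\qquad A_m=\frac{\mathbb{C}[x_m^{\pm1}]}{\langle x_m^n-1\rangle}\quad(1\le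 m\le n-1).$$ The virtual Adams operations on $K(I\mathbb{P}(1,n))_{\mathbb{C}}$ are the $\mathbb{C}$-linear maps $\widetilde\psi^k$ ($k\ge1$) with, for $a\in\mathbb{Z}$, $\widetilde\psi^k(x_0^a)=x_0^{ka}$ and $\widetilde\psi^k(x_m^a)=x_m^{ka}\cdot\sum_{i=0}^{k-1}x_m^{-i}$ for $m\ne0$, where the product is the ordinary one in $A_m$. **Localization.** For $m,l\in\{0,\dots,n-1\}$ let $I_{00}=\langle(x_{00}-1)^2\rangle$ and $I_{ml}=\langle x_{ml}-\zeta^l\rangle$ for $(m,l)\ne(0,0)$. Put $\mathcal{K}=\bigoplus_{m,l}\mathbb{C}[x_{ml}^{\pm1}]/I_{ml}$; $1_{ml}$ is the identity of the $(m,l)$ summand. The map $\Gamma:K(I\mathbb{P}(1,n))_{\mathbb{C}}\to\mathcal{K}$ sends $f(x_m)\in A_m$ to the tuple of classes of $f(x_{ml})$, $l=0,\dots,n-1$; it is an isomorphism of vector spaces. The virtual Adams operations on $\mathcal{K}$ are the transported maps $\Gamma\circ\widetilde\psi^k\circ\Gamma^{-1}$, again denoted $\widetilde\psi^k$. **Generators.** Put $\hat1_{ml}=\frac{1}{1-\zeta^{-l}}1_{ml}$ if $l\ne0$ and $m\neq0$, and $\hat1_{m0}=1_{m0}$, $\hat1_{0l}=1_{0l}$. For $l\ne0$ and $q=0,\dots,n-1$ set $u_l^q=\frac1n\sum_{i=0}^{n-1}\zeta^{-iq}\hat1_{il}$; set $u_0^0=x_{00}-1_{00}$ and $u_0^m=1_{m0}$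 for $m\ne0$. The superscript $q$ is an index, not a power. The element $\mathbf{1}=\sum_{l=0}^{n-1}1_{0l}$ is the identity for the virtual product on $\mathcal{K}$. *)

(* Defs.v *)
From HB Require Import structures.
From mathcomp Require Import all_boot all_order all_algebra.
From mathcomp Require Import generic_quotient ring_quotient.
From mathcomp Require Import finmap monalg.
From mathcomp Require Import boolp classical_sets functions reals trigo.
From mathcomp Require Import complex ring lra.

Set Implicit Arguments.
Unset Strict Implicit.
Unset Printing Implicit Defensive.

Import GRing.Theory Num.Theory.
Local Open Scope ring_scope.
Local Open Scope quotient_scope.

(* Laurent polynomials as finitely supported functions int -> C.  monalg only
   provides the convolution product for exponents in a monomType, whose sole
   invertible element is the unit, so the ring structure for integer exponents
   is built here. *)

Definition laurent (C : comNzRingType) : Type := {malg C[int]}.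

HB.instance Definition _ (C : comNzRingType) := GRing.Lmodule.on (laurent C).

Definition lX {C : comNzRingType} (a : int) : laurent C := << 1 *g a >>.

(* The C-linear map with lX a |-> h a. *)
HB.lock Definition lext (C : comNzRingType) (V : lmodType C) (h : int -> V)
  (f : laurent C) : V := \sum_(a <- msupp f) f@_a *: h a.
Canonical lext_unlockable := Unlockable lext.unlock.

Section LinearExtension.
Context {C : comNzRingType} {V : lmodType C}.
Implicit Types (f g : laurent C) (h : int -> V).

Lemma lextEw h (d : {fset int}) f : (msupp f `<=` d)%fset ->
  lext h f = \sum_(a <- d) f@_a *: h a.
Proof.
move=> le; rewrite unlock (big_fset_incl _ le) => //= x xd /mcoeff_outdom ->.
by rewrite scale0r.
Qed.

Lemma lext_is_linear h : linear (lext h).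
Proof.
move=> c f g; pose d := (msupp f `|` msupp g)%fset.
have df : (msupp f `<=` d)%fset by apply: fsubsetUl.
have dg : (msupp g `<=` d)%fset by apply: fsubsetUr.
have dcfg : (msupp (c *: f + g) `<=` d)%fset.
  by apply: fsubset_trans (msuppD_le _ _) (fsetSU _ (msuppZ_le _ _)).
rewrite (lextEw _ df) (lextEw _ dg) (lextEw _ dcfg) scaler_sumr -big_split /=.
by apply: eq_bigr => a _; rewrite mcoeffD mcoeffZ scalerDl scalerA.
Qed.

HB.instance Definition _ h :=
  GRing.isLinear.Build C (laurent C) V *:%R (lext h) (lext_is_linear h).

Lemma lext_lX h a : lext h (lX a) = h a.
Proof. by rewrite (lextEw _ msuppU_le) big_seq_fset1 mcoeffUU scale1r. Qed.

Lemma laurentE f : f = \sum_(a <- msupp f) f@_a *: lX a.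
Proof.
rewrite [LHS]monalgE; apply: eq_bigr => a _; apply/malgP => b.
by rewrite mcoeffZ !mcoeffU mulrnAr mulr1.
Qed.

Lemma laurent_ext (F G : {linear laurent C -> V}) :
  (forall a, F (lX a) = G (lX a)) -> F =1 G.
Proof.
move=> FG f; rewrite [f]laurentE !linear_sum.
by apply: eq_bigr => a _; rewrite !linearZ /= FG.
Qed.

Lemma eq_lext h1 h2 : h1 =1 h2 -> lext h1 =1 lext h2.
Proof. by move=> h12 f; rewrite unlock; apply: eq_bigr => a _; rewrite h12. Qed.

Lemma lextDl h1 h2 f : lext (fun a => h1 a + h2 a) f = lext h1 f + lext h2 f.
Proof. by rewrite unlock -big_split; apply: eq_bigr => a _; rewrite scalerDr. Qed.

Lemma lextZl c h f : lext (fun a => c *: h a) f = c *: lext h f.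
Proof.
rewrite unlock scaler_sumr; apply: eq_bigr => a _.
by rewrite !scalerA mulrC.
Qed.

End LinearExtension.

Lemma lext_comp (C : comNzRingType) (V W : lmodType C) (F : {linear V -> W})
    (h : int -> V) f :
  F (lext h f) = lext (F \o h) f.
Proof. by rewrite unlock linear_sum; apply: eq_bigr => a _; rewrite linearZ. Qed.

Section LaurentRing.
Context {C : comNzRingType}.
Implicit Types (f g : laurent C).

(* The bilinear extension of lX a * lX b = lX (a + b). *)
Definition lmul f g : laurent C :=
  lext (fun a => lext (fun b => lX (a + b)) g) f.

Definition lmulr g f : laurent C := lmul f g.

Let lmul_linl g : linear (lmulr g). Proof. exact: lext_is_linear. Qed.

Let lmul_linr f : linear (lmul f).
Proof.
move=> c g1 g2; rewrite /lmul -lextZl -lextDl.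
by apply: eq_lext => a; rewrite linearP.
Qed.

Let lmulXX a b : lmul (lX a) (lX b) = lX (a + b).
Proof. by rewrite /lmul !lext_lX. Qed.

HB.instance Definition _ g := GRing.isLinear.Build C (laurent C) (laurent C)
  *:%R (lmulr g) (lmul_linl g).
HB.instance Definition _ f := GRing.isLinear.Build C (laurent C) (laurent C)
  *:%R (lmul f) (lmul_linr f).

Let lmulC : commutative lmul.
Proof.
move=> f g; apply: (@laurent_ext C (laurent C) (lmulr g) (lmul g)) => a /=.
apply: (@laurent_ext C (laurent C) (lmul (lX a)) (lmulr (lX a))) => b /=.
by rewrite /lmulr !lmulXX addrC.
Qed.

Let lmulA : associative lmul.
Proof.
move=> f g k; apply: (@laurent_ext C (laurent C) (lmulr (lmul g k))
  (lmulr k \o lmulr g)) => a /=.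
apply: (@laurent_ext C (laurent C) (lmul (lX a) \o lmulr k)
  (lmulr k \o lmul (lX a))) => b /=.
apply: (@laurent_ext C (laurent C) (lmul (lX a) \o lmul (lX b))
  (lmul (lmul (lX a) (lX b)))) => c /=.
by rewrite /lmulr !lmulXX addrA.
Qed.

Let lmul1 : left_id (lX 0) lmul.
Proof.
move=> f; apply: (@laurent_ext C (laurent C) (lmul (lX 0)) (idfun)) => a /=.
by rewrite lmulXX add0r.
Qed.

Let lmulDl : left_distributive lmul +%R.
Proof. by move=> f g k; exact: (raddfD (lmulr k) f g). Qed.

Let lX0_neq0 : lX 0 != 0 :> laurent C.
Proof. by rewrite monalgU_eq0 oner_neq0. Qed.

HB.instance Definition _ := GRing.Zmodule_isComNzRing.Build (laurent C)
  lmulA lmulC lmul1 lmulDl lX0_neq0.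

Let lscaleAl (c : C) (f g : laurent C) : c *: (f * g) = (c *: f) * g.
Proof. by rewrite -[RHS]/((lmulr g) (c *: f)) linearZ. Qed.

HB.instance Definition _ := GRing.Lmodule_isLalgebra.Build C (laurent C)
  lscaleAl.
HB.instance Definition _ := GRing.Lalgebra_isComAlgebra.Build C (laurent C).

Lemma lX0 : lX 0 = 1 :> laurent C. Proof. by []. Qed.

Lemma lXD a b : lX (a + b) = lX a * lX b :> laurent C.
Proof. by rewrite -lmulXX. Qed.

Lemma lXMn a k : lX (a * k%:Z) = lX a ^+ k :> laurent C.
Proof.
elim: k => [|k IHk]; first by rewrite mulr0 expr0.
by rewrite -addn1 PoszD mulrDr mulr1 lXD IHk addn1 exprSr.
Qed.

End LaurentRing.

Section Quotient.
Context {C : comNzRingType}.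
Implicit Types (p f g : laurent C).

Definition lideal p : {pred laurent C} := fun f => `[< exists g, f = g * p >].

Lemma lidealP p f : reflect (exists g, f = g * p) (f \in lideal p).
Proof. exact: asboolP. Qed.

Let lideal_zmod p : zmod_closed (lideal p).
Proof.
split=> [|f g /lidealP[f' ->] /lidealP[g' ->]]; apply/lidealP.
  by exists 0; rewrite mul0r.
by exists (f' - g'); rewrite mulrBl.
Qed.

HB.instance Definition _ p :=
  GRing.isZmodClosed.Build (laurent C) (lideal p) (lideal_zmod p).

Lemma lidealM p f g : g \in lideal p -> f * g \in lideal p.
Proof. by move=> /lidealP[g' ->]; apply/lidealP; exists (f * g'); rewrite mulrA. Qed.

Definition lquot p : Type := Quotient.quot (lideal p).

HB.instance Definition _ p := GRing.Zmodule.on (lquot p).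
HB.instance Definition _ p := EqQuotient.on (lquot p).

Definition class p f : lquot p := \pi f.

Lemma classK p (q : lquot p) : class p (repr q) = q.
Proof. exact: reprK. Qed.

Lemma eq_class p f g : class p f = class p g <-> f - g \in lideal p.
Proof. by rewrite Quotient.idealrBE; split => [/eqP|/eqP]. Qed.

Let class_is_zmod p : zmod_morphism (class p).
Proof. by move=> f g; rewrite /class !piE. Qed.

HB.instance Definition _ p :=
  GRing.isZmodMorphism.Build (laurent C) (lquot p) (class p) (class_is_zmod p).

Definition qmul p (q r : lquot p) : lquot p := class p (repr q * repr r).

Let qmulE p f g : qmul (class p f) (class p g) = class p (f * g).
Proof.
apply/eq_class; set f' := repr _; set g' := repr _.
have If : f' - f \in lideal p by apply/eq_class; rewrite classK.
have Ig : g' - g \in lideal p by apply/eq_class; rewrite classK.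
have -> : f' * g' - f * g = g' * (f' - f) + f * (g' - g).
  by rewrite !mulrBr (mulrC g' f) (mulrC g') addrA subrK.
by apply: rpredD; apply: lidealM.
Qed.

Let qmulA p : associative (@qmul p).
Proof.
by move=> x y z; rewrite -[x]classK -[y]classK -[z]classK !qmulE mulrA.
Qed.

Let qmulC p : commutative (@qmul p).
Proof. by move=> x y; rewrite -[x]classK -[y]classK !qmulE mulrC. Qed.

Let qmul1 p : left_id (class p 1) (@qmul p).
Proof. by move=> x; rewrite -[x]classK qmulE mul1r. Qed.

Let qmulDl p : left_distributive (@qmul p) +%R.
Proof.
move=> x y z; rewrite -[x]classK -[y]classK -[z]classK.
by rewrite -raddfD !qmulE -raddfD mulrDl.
Qed.

(* comPzRingType rather than comNzRingType: the quotient is trivial when p is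
   invertible. *)
HB.instance Definition _ p := GRing.Zmodule_isComPzRing.Build (lquot p)
  (@qmulA p) (@qmulC p) (@qmul1 p) (@qmulDl p).

Lemma class_is_monoid p : monoid_morphism (class p).
Proof. by split=> // f g; rewrite -qmulE. Qed.

HB.instance Definition _ p :=
  GRing.isMonoidMorphism.Build (laurent C) (lquot p) (class p)
    (class_is_monoid p).

Definition qscale p (c : C) (q : lquot p) : lquot p := class p (c *: 1) * q.

Let qscaleA p c d (q : lquot p) : qscale c (qscale d q) = qscale (c * d) q.
Proof. by rewrite /qscale mulrA -rmorphM /= -scalerAl mul1r scalerA. Qed.

Let qscale1 p : left_id 1 (@qscale p).
Proof. by move=> q; rewrite /qscale scale1r rmorph1 mul1r. Qed.

Let qscaleDr p : right_distributive (@qscale p) +%R.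
Proof. by move=> c q r; rewrite /qscale mulrDr. Qed.

Let qscaleDl p (q : lquot p) : {morph (@qscale p)^~ q : c d / c + d}.
Proof. by move=> c d; rewrite /qscale scalerDl rmorphD mulrDl. Qed.

HB.instance Definition _ p := GRing.Zmodule_isLmodule.Build C (lquot p)
  (@qscaleA p) (@qscale1 p) (@qscaleDr p) (@qscaleDl p).

Let class_is_scalable p : scalable (class p).
Proof.
move=> c f; rewrite -[c *: class p f]/(class p (c *: 1) * class p f).
by rewrite -rmorphM -scalerAl mul1r.
Qed.

HB.instance Definition _ p := GRing.isScalable.Build C (laurent C) (lquot p)
  *:%R (class p) (@class_is_scalable p).

End Quotient.

(* The library has a module structure on {ffun I -> V} for a constant V only. *)

Section DirectSum.
Context {C : comNzRingType} {I : finType} (V : I -> lmodType C).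

Definition dsum : Type := {dffun forall i : I, V i}.

HB.instance Definition _ := Choice.on dsum.

Implicit Types (f g h : dsum).

Definition dsum_zero : dsum := [ffun i => 0].
Definition dsum_opp f : dsum := [ffun i => - f i].
Definition dsum_add f g : dsum := [ffun i => f i + g i].
Definition dsum_scale (c : C) f : dsum := [ffun i => c *: f i].

Let dsum_addA : associative dsum_add.
Proof. by move=> f g h; apply/ffunP => i; rewrite !ffunE addrA. Qed.
Let dsum_addC : commutative dsum_add.
Proof. by move=> f g; apply/ffunP => i; rewrite !ffunE addrC. Qed.
Let dsum_add0 : left_id dsum_zero dsum_add.
Proof. by move=> f; apply/ffunP => i; rewrite !ffunE add0r. Qed.
Let dsum_addN : left_inverse dsum_zero dsum_opp dsum_add.
Proof. by move=> f; apply/ffunP => i; rewrite !ffunE addNr. Qed.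

HB.instance Definition _ := GRing.isZmodule.Build dsum
  dsum_addA dsum_addC dsum_add0 dsum_addN.

Let dsum_scaleA c d f : dsum_scale c (dsum_scale d f) = dsum_scale (c * d) f.
Proof. by apply/ffunP => i; rewrite !ffunE scalerA. Qed.
Let dsum_scale1 : left_id 1 dsum_scale.
Proof. by move=> f; apply/ffunP => i; rewrite !ffunE scale1r. Qed.
Let dsum_scaleDr : right_distributive dsum_scale +%R.
Proof. by move=> c f g; apply/ffunP => i; rewrite !ffunE scalerDr. Qed.
Let dsum_scaleDl f : {morph dsum_scale^~ f : c d / c + d}.
Proof. by move=> c d; apply/ffunP => i; rewrite !ffunE scalerDl. Qed.

HB.instance Definition _ := GRing.Zmodule_isLmodule.Build C dsum
  dsum_scaleA dsum_scale1 dsum_scaleDr dsum_scaleDl.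

Lemma dsumD f g i : (f + g) i = f i + g i. Proof. by rewrite ffunE. Qed.
Lemma dsumZ (c : C) f i : (c *: f) i = c *: f i. Proof. by rewrite ffunE. Qed.

End DirectSum.

Section Inertia.
Context {R : realType} (n : nat).
Local Notation C := R[i].
Implicit Types (k m l : nat).

(* exp(2 pi i / n) *)
Definition zeta : C :=
  (cos (2 * pi / n%:R) +i* sin (2 * pi / n%:R))%C.

(* The sector A_m is the quotient by relA m. *)
Definition relA m : laurent C :=
  if m == 0%N then (lX 1 - 1) * (lX n%:Z - 1) else lX n%:Z - 1.

Definition sector m : lmodType C := lquot (relA m).

Definition KI : lmodType C := dsum (fun m : 'I_n => sector m).

Definition adams_factor m k : lquot (relA m) :=
  if m == 0%N then 1 else \sum_(i < k) class (relA m) (lX (- i%:Z)).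

Definition adams_monomial m k (a : int) : lquot (relA m) :=
  class (relA m) (lX (k%:Z * a)) * adams_factor m k.

(* The C-linear map x_m^a |-> adams_monomial m k a, see adams_sectorX. *)
Definition adams_sector m k (q : sector m) : sector m :=
  lext (adams_monomial m k) (repr q).

Definition virtual_adams k (f : KI) : KI :=
  [ffun m : 'I_n => adams_sector k (f m)].

Section WellDefined.

Definition lsubst k : laurent C -> laurent C := lext (fun a => lX (k%:Z * a)).

HB.instance Definition _ k := GRing.Linear.on (lsubst k).

Lemma lsubst_lX k a : lsubst k (lX a) = lX (k%:Z * a).
Proof. exact: lext_lX. Qed.

Lemma lsubstM k f g : lsubst k (f * g) = lsubst k f * lsubst k g.
Proof.
apply: (@laurent_ext C (laurent C) (lsubst k \o lmulr g)
  (lmulr (lsubst k g) \o lsubst k)) => a /=.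
apply: (@laurent_ext C (laurent C) (lsubst k \o lmul (lX a))
  (lmul (lsubst k (lX a)) \o lsubst k)) => b /=.
change (lsubst k (lX a * lX b) = lsubst k (lX a) * lsubst k (lX b)).
by rewrite -lXD !lsubst_lX mulrDr lXD.
Qed.

Lemma lsubst_relA m k f : f \in lideal (relA m) -> lsubst k f \in lideal (relA m).
Proof.
move=> /lidealP[g ->]; rewrite lsubstM; apply: lidealM.
have lsubstX1 a : lsubst k (lX a - 1) =
    lX a ^+ k - 1.
  by rewrite linearB /= -lX0 !lsubst_lX mulr0 mulrC lXMn lX0.
pose s (a : int) : laurent C := \sum_(i < k) lX a ^+ i.
have subE a : lsubst k (lX a - 1) = s a * (lX a - 1).
  by rewrite lsubstX1 subrX1 mulrC.
apply/lidealP; rewrite /relA; case: ifP => _; last by exists (s n%:Z).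
exists (s 1 * s n%:Z). rewrite lsubstM. rewrite (subE 1). rewrite (subE n%:Z).
exact: mulrACA.
Qed.

Lemma lext_adams m k f :
  lext (adams_monomial m k) f = class (relA m) (lsubst k f) * adams_factor m k.
Proof.
pose s : laurent C := if m == 0%N then 1 else \sum_(i < k) lX (- i%:Z).
have sE : adams_factor m k = class (relA m) s.
  by rewrite /adams_factor /s; case: ifP; rewrite ?rmorph1 ?rmorph_sum.
rewrite sE -rmorphM.
apply: (@laurent_ext C (lquot (relA m)) (lext (adams_monomial m k))
  (class (relA m) \o lmulr s \o lsubst k)) => a /=.
by rewrite lext_lX lsubst_lX /adams_monomial sE -rmorphM.
Qed.

Lemma adams_sector_class m k f :
  adams_sector k (class (relA m) f : sector m) = lext (adams_monomial m k) f.
Proof.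
rewrite /adams_sector.
rewrite 2!lext_adams.
congr (_ * _).
apply/eq_class.
rewrite -linearB.
apply: lsubst_relA.
by apply/eq_class; rewrite classK.
Qed.

Lemma adams_sector_is_linear m k : linear (@adams_sector m k).
Proof.
move=> c q r; rewrite -[q]classK -[r]classK -linearP.
by rewrite !adams_sector_class linearP.
Qed.

Lemma adams_sector0X k a :
  adams_sector k (class (relA 0) (lX a) : sector 0) =
  class (relA 0) (lX (k%:Z * a)).
Proof.
by rewrite adams_sector_class lext_lX /adams_monomial /adams_factor mulr1.
Qed.

Lemma adams_sectorX m k a : m != 0%N ->
  adams_sector k (class (relA m) (lX a) : sector m) =
  class (relA m) (lX (k%:Z * a)) * \sum_(i < k) class (relA m) (lX (- i%:Z)).
Proof.
move=> /negPf m0; rewrite adams_sector_class lext_lX /adams_monomial.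
by rewrite /adams_factor m0.
Qed.

End WellDefined.

Definition relK m l : laurent C :=
  if (m == 0%N) && (l == 0%N) then (lX 1 - 1) ^+ 2
  else lX 1 - (zeta ^+ l)%:A.

Definition KL : lmodType C :=
  dsum (fun p : 'I_n * 'I_n => lquot (relK p.1 p.2) : lmodType C).

Definition Gamma (f : KI) : KL :=
  [ffun p : 'I_n * 'I_n => class (relK p.1 p.2) (repr (f p.1))].

(* 'pinv is the inverse of Gamma, see Gamma_bijective and adams_Gamma. *)
Definition adams k : KL -> KL :=
  Gamma \o virtual_adams k \o 'pinv_(fun=> 0) [set: KI] Gamma.

(* The class of f(x_ml) in the (m,l) summand of KL. *)
Definition summand (m l : 'I_n) (f : laurent C) : KL :=
  [ffun p : 'I_n * 'I_n =>
     if p == (m, l) then class (relK p.1 p.2) f else 0].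

Definition one_ (m l : 'I_n) : KL := summand m l 1.
Definition x_ (m l : 'I_n) : KL := summand m l (lX 1).

Definition hat1 (m l : 'I_n) : KL :=
  if (val m != 0%N) && (val l != 0%N)
  then (1 - zeta ^- l)^-1 *: one_ m l else one_ m l.

(* u l q is u_l^q: the subscript comes first.  For l = 0 the superscript q is the
   sector, so that x_ q l is x_00 when q = l = 0. *)
Definition u (l q : 'I_n) : KL :=
  if val l == 0%N then
    if val q == 0%N then x_ q l - one_ q l else one_ q l
  else n%:R^-1 *: \sum_(i < n) zeta ^- (i * q) *: hat1 i l.

(* The outer sum over m is the single term m = 0. *)
Definition virtual_one : KL :=
  \sum_(m < n | val m == 0%N) \sum_(l < n) one_ m l.

End Inertia.

Section GammaBijective.
Context {R : realType}.
Local Notation C := R[i].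
Local Notation L := (laurent C).
Implicit Types (p q f g : L).

Let cis (t : R) : C := (cos t +i* sin t)%C.

Let cisX t k : cis t ^+ k = cis (t *+ k).
Proof.
elim: k => [|k IHk].
  by rewrite expr0 mulr0n /cis cos0 sin0.
rewrite exprSr IHk mulrSr /cis cosD sinD; apply/eqP; rewrite eq_complex /=.
by apply/andP; split; apply/eqP; ring.
Qed.

Let cis_eq1 t : 0 < t < 2 * pi -> cis t != 1.
Proof.
move=> /andP[t0 t2]; apply/negP => /eqP[cos1 _].
have h : t = (t / 2) *+ 2.
  by rewrite -[RHS]mulr_natr divfK ?pnatr_eq0.
have s0 : 0 < sin (t / 2).
  by apply: sin_gt0_pi; rewrite divr_gt0 //= ltr_pdivrMr // mulrC.
have := exprn_gt0 2 s0; move: cos1; rewrite {1}h cos_mulr2n cos2sin2; lra.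
Qed.

Lemma zeta_primitive n : (0 < n)%N -> n.-primitive_root (@zeta R n).
Proof.
move=> n0; have nR0 : n%:R != 0 :> R by rewrite pnatr_eq0 -lt0n.
apply/andP; split=> //; apply/forallP => i; rewrite unity_rootE.
rewrite /zeta -/(cis _) cisX.
have [->|ne] := eqVneq i.+1 n.
  rewrite -[_ *+ n]mulr_natr divfK // mulr_natl /cis cos2pi sin2pi eqxx //.
rewrite eqbF_neg; apply: cis_eq1.
have lt_in : (i.+1 < n)%N by rewrite ltn_neqAle ne ltn_ord.
rewrite -[_ *+ i.+1]mulr_natr -mulrA; apply/andP; split.
  by rewrite !mulr_gt0 ?invr_gt0 ?ltr0n ?pi_gt0.
rewrite -[ltRHS]mulr1 ltr_pM2l ?mulr_gt0 ?pi_gt0 //.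
by rewrite mulrC ltr_pdivrMr ?ltr0n // mul1r ltr_nat.
Qed.

Let comax p q := exists u v, u * p + v * q = 1.

Let comaxC p q : comax p q -> comax q p.
Proof. by move=> [u [v e]]; exists v, u; rewrite addrC. Qed.

Let comaxM p q1 q2 : comax p q1 -> comax p q2 -> comax p (q1 * q2).
Proof.
move=> [u1 [v1 e1]] [u2 [v2 e2]].
exists (u1 * (u2 * p + v2 * q2) + v1 * q1 * u2), (v1 * v2).
by rewrite -[RHS]mulr1 -{1}e1 -e2; ring.
Qed.

Let comax1 p : comax p 1.
Proof. by exists 0, 1; rewrite mul0r add0r mulr1. Qed.

Let comax_prod (I : Type) (r : seq I) (P : pred I) (F : I -> L) p :
  (forall i, P i -> comax p (F i)) -> comax p (\prod_(i <- r | P i) F i).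
Proof.
move=> h; apply: (big_ind (comax p)) => //.
by move=> *; apply: comaxM.
Qed.

Let comax_lideal p q f :
  comax p q -> f \in lideal p -> f \in lideal q -> f \in lideal (p * q).
Proof.
move=> [u [v e]] /lidealP[a fa] /lidealP[b fb]; apply/lidealP.
exists (u * b + v * a).
by rewrite -[LHS]mulr1 -e mulrDr {1}fb fa; ring.
Qed.

Let lideal_prod (I : finType) (F : I -> L) f :
  (forall i j, i != j -> comax (F i) (F j)) ->
  (forall i, f \in lideal (F i)) -> f \in lideal (\prod_i F i).
Proof.
move=> cF fF; have := index_enum_uniq I.
rewrite -[index_enum I]/(index_enum I); elim: (index_enum I) => [|i r IHr].
  by move=> _; rewrite big_nil; apply/lidealP; exists f; rewrite mulr1.
move=> /= /andP[ir ur]; rewrite big_cons; apply: comax_lideal => //; last exact: IHr.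
rewrite big_seq; apply: comax_prod => j jr; apply: cF.
by apply: contraNneq ir => ->.
Qed.

Let crt (I : finType) (F : I -> L) (t : I -> L) :
  (forall i j, i != j -> comax (F i) (F j)) ->
  exists f, forall i, f - t i \in lideal (F i).
Proof.
move=> cF.
have /fin_all_exists[e he] : forall i, exists e,
    e - 1 \in lideal (F i) /\ forall j, j != i -> e \in lideal (F j).
  move=> i; have [u [v e]] : comax (F i) (\prod_(j | j != i) F j).
    by apply: comax_prod => j ji; apply: cF; rewrite eq_sym.
  exists (v * \prod_(j | j != i) F j); split.
    apply/lidealP; exists (- u); move: e; set Q := \prod_(_ | _) _ => <-; ring.
  move=> j ji; rewrite (bigD1 j) //= [F j * _]mulrC mulrA.
  by apply/lidealP; eexists.
exists (\sum_i t i * e i) => i; rewrite (bigD1 i) //= addrAC.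
apply: rpredD; last by apply: rpred_sum => j ji; apply: lidealM; apply (he j).2; rewrite eq_sym.
by rewrite -{2}[t i]mulr1 -mulrBr; apply: lidealM; apply (he i).1.
Qed.

Context (n : nat) (n_gt0 : (0 < n)%N).
Local Notation zeta := (@zeta R n).
Local Notation relK := (@relK R n).

Let relK_comax m (l1 l2 : 'I_n) : l1 != l2 -> comax (relK m l1) (relK m l2).
Proof.
pose lin (l : 'I_n) : L := lX 1 - (zeta ^+ l)%:A.
move=> ne; have ne' : zeta ^+ l1 != zeta ^+ l2.
  by rewrite (eq_prim_root_expr (zeta_primitive n_gt0)) /= !modn_small.
have c : comax (lin l1) (lin l2).
  pose c := (zeta ^+ l2 - zeta ^+ l1)^-1 *: (1 : L).
  exists c, (- c); rewrite mulNr -mulrBr /lin opprD addrACA subrr add0r opprK.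
  rewrite addrC -scalerBl -scalerAl mul1r scalerA mulVf ?scale1r //.
  by rewrite subr_eq0 eq_sym.
have linE (l : 'I_n) : (m == 0%N) && (nat_of_ord l == 0%N) -> relK m l = lin l * lin l.
  rewrite /relK => h; rewrite h; move: h => /andP[_ /eqP l0].
  by rewrite /lin l0 expr0 scale1r expr2.
have linE' (l : 'I_n) : ((m == 0%N) && (nat_of_ord l == 0%N)) = false -> relK m l = lin l.
  by rewrite /relK => ->.
case h1 : ((m == 0%N) && (nat_of_ord l1 == 0%N));
  case h2 : ((m == 0%N) && (nat_of_ord l2 == 0%N));
  rewrite ?(linE _ h1) ?(linE _ h2) ?(linE' _ h1) ?(linE' _ h2) //.
- by apply: comaxM; apply: comaxC; apply: comaxM; apply: comaxC.
- by apply: comaxC; apply: comaxM; apply: comaxC.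
- exact: comaxM.
Qed.

Let relA_prod m : @relA R n m = \prod_(l < n) relK m l.
Proof.
pose lin (l : nat) : L := lX 1 - (zeta ^+ l)%:A.
have XnE : lX n%:Z - 1 = \prod_(l < n) lin l.
  have := congr1 (horner_alg (lX 1 : L)) (factor_Xn_sub_1 (zeta_primitive n_gt0)).
  rewrite rmorph_prod rmorphB rmorph1 rmorphXn /= horner_algX -lXMn mul1r => <-.
  rewrite big_mkord; apply: eq_bigr => l _.
  by rewrite rmorphB /= horner_algX horner_algC.
rewrite /relA; case: ifP => m0; rewrite XnE; last first.
  by apply: eq_bigr => l _; rewrite /relK m0.
rewrite [RHS](bigD1 (Ordinal n_gt0)) //= (bigD1 (Ordinal n_gt0)) //= mulrA.
congr (_ * _); first by rewrite /relK m0 /= /lin expr0 scale1r expr2.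
apply: eq_bigr => l; rewrite -val_eqE /= /relK m0 => /negPf -> //.
Qed.

Let relA_relK m (l : 'I_n) f : f \in lideal (@relA R n m) -> f \in lideal (relK m l).
Proof.
move=> /lidealP[g ->]; rewrite relA_prod (bigD1 l) //= [relK m l * _]mulrC mulrA.
by apply/lidealP; eexists.
Qed.

Let relK_relA m f :
  (forall l : 'I_n, f \in lideal (relK m l)) -> f \in lideal (@relA R n m).
Proof. by move=> h; rewrite relA_prod; apply: lideal_prod => //; apply: relK_comax. Qed.

(* Gamma sends the class of f(x_m) to the tuple of the classes of f(x_ml). *)
Lemma Gamma_class (F : @KI R n) (f : 'I_n -> L) (m l : 'I_n) :
  F m = class _ (f m) -> Gamma F (m, l) = class (relK m l) (f m).
Proof.
move=> Ff; rewrite ffunE /=; apply/eq_class; apply: relA_relK; apply/eq_class.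
by rewrite -Ff classK.
Qed.

Lemma Gamma_is_linear : linear (@Gamma R n).
Proof.
move=> c F G; apply/ffunP => -[m l].
rewrite dsumD dsumZ !ffunE /= -linearP; apply/eq_class; apply: relA_relK.
by apply/eq_class; rewrite classK linearP /= !classK.
Qed.

Lemma Gamma_bijective : bijective (@Gamma R n).
Proof.
have inj : injective (@Gamma R n).
  move=> F G FG; apply/ffunP => m; rewrite -[F m]classK -[G m]classK.
  apply/eq_class; apply: relK_relA => l.
  apply/eq_class; have := congr1 (fun H : @KL R n => H (m, l)) FG.
  by rewrite !ffunE.
have surj : forall G, exists F, @Gamma R n F = G.
  move=> G; have /fin_all_exists[f hf] : forall m : 'I_n, exists f : L,
      forall l : 'I_n, f - repr (G (m, l)) \in lideal (relK m l).
    by move=> m; apply: crt => l1 l2; apply: relK_comax.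
  exists [ffun m : 'I_n => class (@relA R n m) (f m)]; apply/ffunP => -[m l].
  rewrite (@Gamma_class _ f) ?ffunE //; rewrite -[RHS]classK; apply/eq_class.
  exact: hf.
have [g gK] := choice surj.
by exists g => // F; apply: inj; rewrite gK.
Qed.

Lemma adams_Gamma k (F : @KI R n) :
  adams k (Gamma F) = Gamma (virtual_adams k F).
Proof.
rewrite /adams /=; congr (Gamma (virtual_adams k _)).
by apply: pinvKV; rewrite ?in_setE //; move=> x y _ _; apply: (bij_inj Gamma_bijective).
Qed.

End GammaBijective.

Arguments KI R n : clear implicits.
Arguments KL R n : clear implicits.

(* Main.v *)
Require Import Defs.
From mathcomp Require Import all_boot all_order all_algebra.
From mathcomp Require Import reals complex.

(* On the sector m the operation is f(x) |-> f(x^k) s(x) with s = 1 for m = 0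
   and s = sum_(i < k) x^-i otherwise, so after localization the coordinate of
   psi^k(G) at zeta^l is the coordinate of G at zeta^(k l), multiplied by
   s(zeta^l).  This value is k at l = 0 and the quotient
   (1 - zeta^-(k l)) / (1 - zeta^-l) elsewhere: the normalisation of hat1 turns
   it into a permutation-like rule, and it kills the coordinates with l <> 0 and
   k l = 0 mod n.  At the double point x_00 = 1 the map x |-> x^k acts on the
   tangent direction x - 1 as multiplication by k. *)

Set Implicit Arguments.
Unset Strict Implicit.
Unset Printing Implicit Defensive.

Import GRing.Theory Num.Theory.
Local Open Scope ring_scope.

(** * Linear congruences modulo [n] *)

Lemma eqn_modMl_coprime (n k x y : nat) : coprime n k ->
  (k * x == k * y %[mod n])%N = (x == y %[mod n])%N.
Proof.
move=> cop; wlog le_yx : x y / (y <= x)%N.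
  by move=> H; case/orP: (leq_total y x) => /H //; rewrite eq_sym => ->; rewrite eq_sym.
by rewrite !eqn_mod_dvd ?leq_mul2l ?le_yx ?orbT // -mulnBr Gauss_dvdr.
Qed.

(** Dividing by [d = gcdn k n] leaves k' y = l' mod n' with k' coprime to n'. This has one solution
    y0 mod n', whose lifts y0 + n' i with i < d are the solutions below n = n' d. *)
Lemma linear_congruence_solutions (n k l : nat) : (0 < n)%N -> (gcdn k n %| l)%N ->
  exists2 s : (gcdn k n).-tuple 'I_n, uniq s &
    forall y : 'I_n, (y \in s) = (k * y == l %[mod n])%N.
Proof.
move=> n_gt0; have d_gt0 : (0 < gcdn k n)%N by rewrite gcdn_gt0 n_gt0 orbT.
move: (dvdn_gcdl k n) (dvdn_gcdr k n); move dE: (gcdn k n) d_gt0 => d d_gt0.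
move=> /dvdnP[k' kE] /dvdnP[n' nE] /dvdnP[l' ->].
have cop : coprime n' k'.
  by rewrite /coprime gcdnC -(eqn_pmul2r d_gt0) muln_gcdl -kE -nE mul1n dE.
have n'_gt0 : (0 < n')%N by move: n_gt0; rewrite nE muln_gt0 => /andP[].
(* [c] is congruent to l' mod n' and divisible by k', so [c %/ k'] solves the reduced congruence. *)
pose c := chinese n' k' l' 0; pose y0 := ((c %/ k') %% n')%N.
have k'c : (k' * (c %/ k') = c)%N.
  by rewrite mulnC divnK // /dvdn; apply/eqP; rewrite (chinese_modr cop) mod0n.
have y0P i : (i < d)%N -> (y0 + n' * i < n)%N.
  move=> id; rewrite nE; apply: (@leq_trans (n' * i.+1)).
    by rewrite mulnS ltn_add2r ltn_pmod.
  by rewrite leq_mul2l id orbT.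
exists [tuple Ordinal (y0P i (ltn_ord i)) | i < d].
  rewrite map_inj_uniq ?enum_uniq // => i j /(congr1 val) /= /eqP.
  by rewrite eqn_add2l eqn_mul2l eqn0Ngt n'_gt0 /= => /eqP /val_inj.
move=> y; transitivity (y == c %/ k' %[mod n'])%N.
  apply/mapP/eqP => [[i _ ->] /=|yE].
    by rewrite mulnC addnC modnMDl modn_mod.
  have yd : (y %/ n' < d)%N by rewrite ltn_divLR // mulnC -nE.
  exists (Ordinal yd); rewrite ?mem_enum //; apply: val_inj => /=.
  by rewrite {1}(divn_eq y n') yE mulnC addnC.
rewrite -(eqn_modMl_coprime _ _ cop) k'c (chinese_modl cop).
rewrite -(eqn_pmul2r d_gt0) !muln_modl -nE.
by congr (_ %% _ == _)%N; rewrite kE mulnAC.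
Qed.

(** * Scalars and powers of x in quotients of the Laurent ring *)

Section LaurentQuotient.
Context {C : comNzRingType}.
Implicit Types (p f g : laurent C) (c : C).

Lemma class_scalar p c : class p c%:A = c *: (1 : lquot p).
Proof. by rewrite linearZ /= rmorph1. Qed.

Lemma class_scalarM p c d f : class p f = d *: (1 : lquot p) ->
  class p (c%:A * f) = (c * d) *: (1 : lquot p).
Proof. by move=> fd; rewrite -scalerAl mul1r linearZ /= fd scalerA. Qed.

Lemma lX_mulr_nat (k : nat) : lX k%:Z = lX 1 ^+ k :> laurent C.
Proof. by rewrite -lXMn mul1r. Qed.

Lemma lXVn (i : nat) : lX (- i%:Z) * lX 1 ^+ i = 1 :> laurent C.
Proof. by rewrite -lX_mulr_nat -lXD addNr. Qed.

End LaurentQuotient.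

(** * Coordinates of the Adams operations on the localization *)

Section Localization.
Context {R : realType} {n : nat} (n_gt0 : (0 < n)%N).
Local Notation C := R[i].
Local Notation zeta := (@zeta R n).
Local Notation relK := (@relK R n).
Implicit Types (m l k : nat) (f t : laurent C).

Lemma relKE m l :
  relK m l = (lX 1 - (zeta ^+ l)%:A) ^+ ((m == 0%N) && (l == 0%N)).+1.
Proof.
rewrite /Defs.relK; case: ifP => //= /andP[_ /eqP ->].
by rewrite expr0 scale1r.
Qed.

Lemma lsubst_scalar k (c : C) : lsubst k c%:A = c%:A.
Proof. by rewrite linearZ /= -lX0 lsubst_lX mulr0. Qed.

Lemma lsubstX k f e : lsubst k (f ^+ e) = lsubst k f ^+ e.
Proof.
elim: e => [|e IHe]; last by rewrite !exprS lsubstM IHe.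
by rewrite !expr0 -[1]scale1r lsubst_scalar.
Qed.

Lemma zeta_exp_eq1 l : (l < n)%N -> (zeta ^+ l == 1) = (l == 0%N).
Proof.
move=> ln; rewrite -(expr0 zeta) (eq_prim_root_expr (zeta_primitive n_gt0)).
by rewrite !modn_small.
Qed.

Lemma zeta_exp_congr k l l' : (k * l == l' %[mod n])%N -> zeta ^+ l' = (zeta ^+ l) ^+ k.
Proof.
move=> kl; rewrite -exprM mulnC; apply/eqP.
by rewrite (eq_prim_root_expr (zeta_primitive n_gt0)) eq_sym.
Qed.

(** With w = zeta^l, the root zeta^l' equals w^k, and x - w divides x^k - w^k. *)
Lemma lsubst_relK k m (l l' : 'I_n) : (k * l == l' %[mod n])%N ->
  lsubst k (relK m l') \in lideal (relK m l).
Proof.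
move=> kl; rewrite !relKE lsubstX linearB /= lsubst_scalar lsubst_lX mulr1.
rewrite lX_mulr_nat (zeta_exp_congr kl).
have -> : (((zeta ^+ l) ^+ k)%:A : laurent C) = (zeta ^+ l)%:A ^+ k.
  by rewrite exprZn expr1n.
rewrite subrXX [_ * \sum_(i < k) _]mulrC exprMn.
apply: lidealM; set e := (_ && _); set e' := (_ && _).
(* The target relation is a square only for m = l = 0; the congruence then forces l' = 0, so the
   source relation is a square as well. *)
suff /subnK <- : (e'.+1 <= e.+1)%N.
  by rewrite exprD; apply/lidealP; eexists.
rewrite ltnS /e /e'; case: (m == 0%N) => //=.
case: eqP => [l0|//]; move: kl; rewrite l0 muln0 mod0n eq_sym modn_small //.
by move=> ->.
Qed.

Lemma class_relK_linear m l : ~~ ((m == 0%N) && (l == 0%N)) ->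
  class (relK m l) (lX 1) = class (relK m l) (zeta ^+ l)%:A.
Proof.
by move=> ml; apply/eq_class/lidealP; exists 1; rewrite mul1r relKE (negPf ml).
Qed.

(** A lift of [adams_factor m k] to Laurent polynomials, which can be reduced in every summand (m,
    l). *)
Definition adams_twist m k : laurent C :=
  if m == 0%N then 1 else \sum_(i < k) lX (- i%:Z).

(** As [Gamma] is onto, [G] comes from some F, on which the operation is f(x) |-> f(x^k) times the
    twist. By [lsubst_relK] the class at l only depends on f modulo the relation at l', so any
    representative [t] there will do. *)
Lemma adams_coord k (G : KL R n) (m l l' : 'I_n) t : (k * l == l' %[mod n])%N ->
  G (m, l') = class (relK m l') t ->
  adams k G (m, l) = class (relK m l) (lsubst k t * adams_twist m k).
Proof.
move=> kl; have [g _ gK] := Gamma_bijective (R := R) n_gt0.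
rewrite -(gK G); move: (g G) => {gK} {G}F.
rewrite adams_Gamma // ffunE /= => /eq_class Ft.
rewrite (@Gamma_class _ _ n_gt0 _
  (fun m : 'I_n => lsubst k (repr (F m)) * adams_twist m k) m); last first.
  rewrite ffunE /= -{1}[F m]classK adams_sector_class lext_adams rmorphM /=.
  congr (_ * _); rewrite /adams_factor /adams_twist.
  by case: ifP; rewrite ?rmorph1 ?rmorph_sum.
apply/eq_class; rewrite -mulrBl mulrC; apply: lidealM; rewrite -linearB /=.
by case/lidealP: Ft => h ->; rewrite lsubstM; apply: lidealM; apply: lsubst_relK.
Qed.

(** The value of [adams_twist m k] at x = zeta^l. *)
Definition twist_value k m l : C :=
  if m == 0%N then 1 else \sum_(i < k) zeta ^- (l * i).

(** For m = 0 the twist is 1, even at the double point; for other m the relation is linear and x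
    acts as zeta^l. *)
Lemma class_twist k m l :
  class (relK m l) (adams_twist m k) =
  twist_value k m l *: (1 : lquot (relK m l)).
Proof.
rewrite /adams_twist /twist_value; case: ifPn => [_|m0].
  by rewrite (rmorph1 (class (relK m l))) scale1r.
rewrite rmorph_sum scaler_suml; apply: eq_bigr => i _ /=.
have z0 : zeta ^+ (l * i) != 0.
  apply: expf_neq0; have := oner_neq0 C.
  by rewrite -(prim_expr_order (zeta_primitive n_gt0)) expf_eq0 n_gt0.
have Xz : class (relK m l) (lX 1) = class (relK m l) (zeta ^+ l)%:A.
  by rewrite class_relK_linear // negb_and m0.
have := congr1 (class (relK m l)) (lXVn (C := C) i).
rewrite rmorphM rmorphXn /= Xz -rmorphXn -rmorphM /= exprZn expr1n -exprM.
rewrite -scalerAr mulr1 linearZ rmorph1 /= => <-.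
by rewrite scalerA mulVf // scale1r.
Qed.

End Localization.

Lemma dsum_sum (C : comNzRingType) (I : finType) (V : I -> lmodType C)
    (J : Type) (r : seq J) (P : pred J) (F : J -> dsum V) (i : I) :
  (\sum_(j <- r | P j) F j) i = \sum_(j <- r | P j) F j i.
Proof.
by apply: (big_morph (fun f : dsum V => f i)) => [f g|]; rewrite ?dsumD ?ffunE.
Qed.

(** * Action on the generators, computed coordinate by coordinate *)

Section Adams.
Context {R : realType} {n : nat} (n_gt0 : (0 < n)%N) (k : nat).
Local Notation C := R[i].
Local Notation zeta := (@zeta R n).
Local Notation relK := (@relK R n).
Local Notation K m l := (lquot (relK m l)).
Implicit Types (m l q : 'I_n).

Lemma residue_ord (a : nat) :
  exists r : 'I_n, forall j : 'I_n, (a == j %[mod n])%N = (r == j).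
Proof.
exists (Ordinal (ltn_pmod a n_gt0)) => j.
by rewrite -val_eqE /= (modn_small (ltn_ord j)).
Qed.

(** The substitution x |-> x^k fixes constants, so only the twist acts. *)
Lemma adams_scalar_coord (G : KL R n) m l l' (c : C) : (k * l == l' %[mod n])%N ->
  G (m, l') = c *: (1 : K m l') ->
  adams k G (m, l) = (c * twist_value (n := n) k m l) *: (1 : K m l).
Proof.
move=> kl Gc; rewrite (adams_coord (t := c%:A) n_gt0 kl); last first.
  by rewrite Gc class_scalar.
by rewrite lsubst_scalar; apply: class_scalarM; apply: class_twist.
Qed.

Lemma one_coord m l m' l' :
  one_ m l (m', l') = ((m' == m) && (l' == l))%:R *: (1 : K m' l').
Proof.
rewrite ffunE xpair_eqE /=.
by case: andP => _; rewrite ?scale1r ?scale0r ?rmorph1 ?raddf0.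
Qed.

Definition hat1_coef (m l : nat) : C :=
  if (m != 0%N) && (l != 0%N) then (1 - zeta ^- l)^-1 else 1.

Lemma hat1_coord m l m' l' :
  hat1 m l (m', l') =
  (hat1_coef m l * ((m' == m) && (l' == l))%:R) *: (1 : K m' l').
Proof.
rewrite /hat1 /hat1_coef; case: ifP => _; last by rewrite mul1r one_coord.
by rewrite dsumZ one_coord scalerA.
Qed.

Definition u_coef (m l q : nat) : C :=
  n%:R^-1 * (zeta ^- (m * q) * hat1_coef m l).

Lemma u_coord l q m l' : l != 0%N :> nat ->
  u l q (m, l') = (u_coef m l q * (l' == l)%:R) *: (1 : K m l').
Proof.
move=> l0; rewrite /u (negPf l0) dsumZ dsum_sum.
have E (i : 'I_n) : (zeta ^- (i * q) *: hat1 i l : KL R n) (m, l') =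
    (zeta ^- (i * q) * hat1_coef i l * ((m == i) && (l' == l))%:R) *: (1 : K m l').
  by rewrite dsumZ hat1_coord scalerA mulrA.
rewrite (eq_bigr _ (fun i _ => E i)) -scaler_suml scalerA.
have -> // : n%:R^-1 *
  \sum_(i < n) zeta ^- (i * q) * hat1_coef i l * ((m == i) && (l' == l))%:R =
  u_coef m l q * (l' == l)%:R.
rewrite (big_only1 m) // => [|i im _]; last by rewrite eq_sym (negPf im) mulr0.
by rewrite eqxx mulrA.
Qed.

Lemma twist_geometric l l0 : (k * l == l0 %[mod n])%N -> l != 0%N :> nat ->
  \sum_(i < k) zeta ^- (l * i) = (1 - zeta ^- l0) / (1 - zeta ^- l).
Proof.
move=> kl lne; have w1 : 1 - zeta ^- l != 0.
  by rewrite subr_eq0 eq_sym invr_eq1 zeta_exp_eq1.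
apply: (canRL (mulfK w1)); rewrite mulrC.
under eq_bigr => i _ do rewrite exprM -exprVn.
apply: oppr_inj; rewrite -mulNr !opprB -subrX1 exprVn.
by rewrite -(zeta_exp_congr n_gt0 kl).
Qed.

(** At (m, l) both sides vanish unless k l = l0 mod n; then the only term of the sum that
    contributes is y = l. *)
Lemma adams_u l0 q : l0 != 0%N :> nat ->
  adams k (u l0 q : KL R n) = \sum_(y < n | (k * y == l0 %[mod n])%N) u y q.
Proof.
move=> l0ne; have yne (y : 'I_n) : (k * y == l0 %[mod n])%N -> y != 0%N :> nat.
  apply: contraTneq => ->; rewrite muln0 mod0n modn_small //.
  by rewrite eq_sym.
apply/ffunP => -[m l]; have [l' l'E] := residue_ord (k * l).
have kl' : (k * l == l' %[mod n])%N by rewrite l'E.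
rewrite (adams_scalar_coord kl' (u_coord q m l' l0ne)) dsum_sum.
rewrite (eq_bigr _ (fun y ky => u_coord q m l (yne y ky))) -scaler_suml.
have -> // : u_coef m l0 q * (l' == l0)%:R * twist_value (n := n) k m l =
  \sum_(y < n | (k * y == l0 %[mod n])%N) u_coef m y q * (l == y)%:R.
rewrite -l'E.
have [kl|kl] := boolP (_ == _ %[mod _])%N; last first.
  rewrite mulr0 mul0r big1 // => y ky.
  by case: eqP => [ly|_]; [rewrite ly ky in kl | rewrite mulr0].
rewrite (big_only1 l) // => [|y yl _]; last by rewrite eq_sym (negPf yl) mulr0.
rewrite eqxx !mulr1 /u_coef /hat1_coef /twist_value l0ne (yne _ kl) !andbT.
case: eqP => _ /=; rewrite ?mulr1 //.
(* The normalisation of [hat1] at l0 cancels the numerator of the twist; the denominator left over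
   is the normalisation at l. *)
rewrite (twist_geometric kl (yne _ kl)) -!mulrA; congr (_ * (_ * _)).
by rewrite mulKf // subr_eq0 eq_sym invr_eq1 zeta_exp_eq1.
Qed.

Lemma class_relK00 :
  class (relK 0 0) (lX 1 ^+ k - 1) = k%:R *: class (relK 0 0) (lX 1 - 1).
Proof.
rewrite -linearZ /=; apply/eq_class.
rewrite subrX1 relKE /= expr0 scale1r expr2 mulrC -mulr_algl -mulrBl.
(* Written as a sum of k terms x^i - 1, the cofactor supplies the second factor x - 1. *)
rewrite [_ - _](_ : _ = (\sum_(i < k) \sum_(j < i) lX 1 ^+ j) * (lX 1 - 1)); last first.
  rewrite mulr_suml; under [RHS]eq_bigr do rewrite mulrC -subrX1.
  by rewrite sumrB sumr_const card_ord scaler_nat.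
by apply/lidealP; eexists; rewrite -mulrA.
Qed.

(** The factor k has two sources: for q nonzero it is the value of the twist at x = 1, for q = 0 it
    is the derivative of x^k at the double point. *)
Lemma adams_u0 l q : l = 0%N :> nat -> adams k (u l q : KL R n) = k%:R *: u l q.
Proof.
move=> l0; apply/ffunP => -[m y].
rewrite dsumZ /u (_ : (val l == 0%N) = true); last by rewrite /= l0.
have [l' l'E] := residue_ord (k * y).
have kl' : (k * y == l' %[mod n])%N by rewrite l'E.
have y0l' : y = 0%N :> nat -> l' == l by rewrite -l'E l0 => ->; rewrite muln0.
have yl : (y == l) = (y == 0%N :> nat) by rewrite -val_eqE /= l0.
have ky0 : l' == l -> (k * y == l %[mod n])%N by rewrite l'E.
have [q0|q0] := eqVneq (val q) 0%N; last first.
  rewrite (adams_scalar_coord kl' (one_coord _ _ _ _)) one_coord scalerA.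
  have -> // : ((m == q) && (l' == l))%:R * twist_value (n := n) k m y =
    k%:R * ((m == q) && (y == l))%:R :> C.
  case: (eqVneq m q) => [->|_]; last by rewrite /= mul0r mulr0.
  rewrite /= /twist_value (negPf q0) yl; case: (eqVneq (y : nat) 0%N) => [y0|yne].
    rewrite y0l' // mul1r mulr1 y0.
    by under eq_bigr do rewrite mul0n expr0 invr1; rewrite sumr_const card_ord.
  (* At y nonzero with k y = 0 mod n, the geometric quotient has numerator 1 - 1 = 0. *)
  rewrite mulr0; case: eqP => [/eqP/ky0 ky|_]; last by rewrite mul0r.
  by rewrite (twist_geometric ky yne) l0 expr0 invr1 subrr !mul0r mulr0.
have uE (l1 : 'I_n) : (x_ q l - one_ q l) (m, l1) =
    class (relK m l1) (if (m, l1) == (q, l) then lX 1 - 1 else 0).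
  rewrite !ffunE /=; case: ifP => _; first by rewrite raddfB.
  by rewrite subrr raddf0.
rewrite (adams_coord n_gt0 kl' (uE l')) uE !xpair_eqE yl.
have [mq|_] := eqVneq m q; last by rewrite /= raddf0 mul0r raddf0 scaler0.
have m0 : m = 0%N :> nat by rewrite mq.
rewrite /= /adams_twist m0 eqxx mulr1.
have E : lsubst k (lX 1 - 1) = lX 1 ^+ k - 1 :> laurent C.
  by rewrite linearB /= -lX0 !lsubst_lX mulr0 mulr1 lX_mulr_nat.
case: (eqVneq (y : nat) 0%N) => [y0|yne].
  by rewrite y0l' // E y0 class_relK00.
rewrite raddf0 scaler0; case: eqP => [/eqP/ky0 ky|_]; last by rewrite !raddf0.
(* At y nonzero the relation is linear, so x becomes zeta^y, whose k-th power is 1; hence x^k - 1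
   vanishes. *)
rewrite E rmorphB rmorphXn /= -m0 class_relK_linear ?negb_and ?yne ?orbT //.
rewrite -rmorphXn /= exprZn expr1n -(zeta_exp_congr n_gt0 ky) l0 expr0 scale1r.
by rewrite rmorph1 subrr.
Qed.

(** The coordinates of [virtual_one] depend on m alone, and in the sector m = 0 where they are
    nonzero the twist is 1. *)
Lemma adams_virtual_one : adams k (virtual_one n : KL R n) = virtual_one n.
Proof.
have oneE m l : virtual_one n (m, l) = (m == 0%N :> nat)%:R *: (1 : K m l).
  have E (i : 'I_n) : (\sum_j one_ i j : KL R n) (m, l) =
      (\sum_(j < n) ((m == i) && (l == j))%:R) *: (1 : K m l).
    rewrite dsum_sum (eq_bigr _ (fun j _ => one_coord i j m l)).
    by rewrite -scaler_suml.
  rewrite /virtual_one dsum_sum (eq_bigr _ (fun i _ => E i)) -scaler_suml.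
  have -> // : \sum_(i < n | val i == 0%N) \sum_(j < n) ((m == i) && (l == j))%:R =
    (m == 0%N :> nat)%:R :> C.
  transitivity (\sum_(i < n | val i == 0%N) (m == i)%:R : C).
    apply: eq_bigr => i _; rewrite (big_only1 l) ?eqxx ?andbT // => j jl _.
    by rewrite [l == j]eq_sym (negPf jl) andbF.
  case: eqP => m0.
    rewrite (big_only1 m) ?eqxx //= ?m0 // => i im _.
    by rewrite eq_sym (negPf im).
  by rewrite big1 // => i /eqP i0; case: eqP => // mi; case: m0; rewrite mi.
apply/ffunP => -[m l]; have [l' l'E] := residue_ord (k * l).
have kl' : (k * l == l' %[mod n])%N by rewrite l'E.
rewrite (adams_scalar_coord kl' (oneE m l')) oneE /twist_value.
by case: ifP; rewrite ?mulr1 ?mul0r.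
Qed.

End Adams.

Theorem proposition6p4 (R : realType) (n k : nat)
    (n_ge2 : (2 <= n)%N) (k_ge1 : (1 <= k)%N) :
  [/\ forall l q : 'I_n, nat_of_ord l = 0%N ->
        adams k (u l q : KL R n) = k%:R *: u l q,
      forall l : 'I_n, nat_of_ord l <> 0%N -> (gcdn k n %| l)%N ->
        exists s : (gcdn k n).-tuple 'I_n,
          [/\ uniq s,
              forall y : 'I_n, (y \in s) = (k * y == l %[mod n])%N
            & forall q : 'I_n,
                adams k (u l q : KL R n) =
                \sum_(i < gcdn k n) u (tnth s i) q],
      forall l q : 'I_n, ~~ (gcdn k n %| l)%N ->
        adams k (u l q : KL R n) = 0
    & adams k (virtual_one n : KL R n) = virtual_one n].
Proof.
have n_gt0 : (0 < n)%N by apply: ltnW.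
split.
- by move=> l q; apply: adams_u0.
- move=> l /eqP l0 dl; have [s s_uniq sE] := linear_congruence_solutions n_gt0 dl.
  exists s; split=> // q; rewrite adams_u // -(big_tuple _ _ s xpredT (fun y => u y q)).
  by rewrite big_uniq //=; apply: eq_bigl => y; rewrite sE.
- move=> l q dl; rewrite adams_u //; last first.
    by apply: contraNneq dl => ->; rewrite dvdn0.
  (* The sum is empty: since [gcdn k n] divides both k and n, a solution y of k y = l mod n would
     make it divide l. *)
  rewrite big_pred0 // => y; apply: contraNF dl => /eqP ky.
  have dn := dvdn_gcdr k n; rewrite /dvdn -(modn_dvdm _ dn) -ky (modn_dvdm _ dn).
  by rewrite -/(dvdn _ _) dvdn_mulr // dvdn_gcdl.
- exact: adams_virtual_one.
Qed.
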